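(* Let $p$ be a prime, $i,j$ non-negative integers and $\varepsilon\in\{0,1\}$. The map $$\tilde\mu_{2i+\varepsilon}^{2i(p-1)+\varepsilon,j}\colon E_{2i+\varepsilon}^{2i(p-1)+\varepsilon}\mathcal A_p\otimes(\mathcal A_p/F_{2i-j+\varepsilon+1}\mathcal A_p)^j\to E_{2i-j+\varepsilon}^{2i(p-1)+j+\varepsilon}\mathcal A_p$$ induced by the product of $\mathcal A_p$ is an isomorphism.
   Context: Let $p$ be a prime and $\mathcal A_p$ the mod $p$ Steenrod algebra ($\mathcal A_p^k$ its degree-$k$ part). The excess filtration: $F_i\mathcal A_p$ is the span of admissible monomials $\beta^{\varepsilon_0}\wp^{i_1}\beta^{\varepsilon_1}\cdots\wp^{i_n}\beta^{\varepsilon_n}$ ($\varepsilon_s\in\{0,1\}$, $i_s\ge pi_{s+1}+\varepsilon_s$) with excess $\sum_{s=0}^n\varepsilon_s+2\sum_{s=1}^n(i_s-pi_{s+1}-\varepsilon_s)\ge i$ (with $i_{n+1}=0$) if $p$ is odd, resp. of admissible $Sq^{j_1}\cdots Sq^{j_n}$ ($j_s\ge2j_{s+1}$) with excess $\sum_s(j_s-2j_{s+1})\ge i$ if $p=2$; $F_i\mathcal A_p=\mathcal A_p$ for $i\le0$. $E_i^k\mathcal A_p=(F_i\mathcal A_p)^k/(F_{i+1}\mathcal A_p)^k$. Since each $F_i\mathcal A_p$ is a left ideal and $F_i\mathcal A_p\cdot\mathcal A_p^j\subset F_{i-j}\mathcal A_p$, the product induces well-defined maps $\tilde\mu_i^{k,j}\colon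 E_i^k\mathcal A_p\otimes(\mathcal A_p/F_{i-j+1}\mathcal A_p)^j\to E_{i-j}^{k+j}\mathcal A_p$, $[a]\otimes[b]\mapsto[ab]$. *)

(* Defs.v *)
From HB Require Import structures.
From mathcomp Require Import all_boot all_order all_algebra.
Set Implicit Arguments. Unset Strict Implicit. Unset Printing Implicit Defensive.
Import Order.TTheory GRing.Theory Num.Theory.
Local Open Scope ring_scope.

(* The mod p Steenrod algebra is modelled as ANY F_p-algebra A with
   distinguished elements (beta, P^i for p odd; Sq^i for p = 2) satisfying
   the Adem relations and such that the admissible monomials form a basis.
   Such an A is isomorphic to the Steenrod algebra (compatibly with the
   generators). *)

Section Steenrod.
Variable p : nat.
Local Notation F := 'F_p.

(* ---------- odd primes: beta^{e0} P^{i1} beta^{e1} ... P^{in} beta^{en} --- *)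
Definition odd_mono := (bool * seq (nat * bool))%type.

(* the sequence i_2, ..., i_n, i_{n+1} = 0 *)
Definition next_pows (s : seq (nat * bool)) : seq nat :=
  rcons (behead (map fst s)) 0%N.

Definition adm_odd (m : odd_mono) : bool :=
  all (fun x : nat * bool => 0 < x.1)%N m.2 &&
  all (fun xy : nat * bool * nat => p * xy.2 + xy.1.2 <= xy.1.1)%N (zip m.2 (next_pows m.2)).

Definition exc_odd (m : odd_mono) : nat :=
  (m.1 + \sum_(x <- m.2) (x.2 : nat)
   + 2 * \sum_(xy <- zip m.2 (next_pows m.2)) ((xy : nat * bool * nat).1.1 - p * xy.2 - xy.1.2))%N.

Definition deg_odd (m : odd_mono) : nat :=
  (m.1 + \sum_(x <- m.2) (2 * x.1 * (p - 1) + x.2))%N.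

Definition mono_odd (A : algType F) (b : A) (P : nat -> A) (m : odd_mono) : A :=
  b ^+ m.1 * \prod_(x <- m.2) (P x.1 * b ^+ x.2).

Definition next2 (s : seq nat) : seq nat := rcons (behead s) 0%N.

Definition adm2 (s : seq nat) : bool :=
  all (fun x => 0 < x)%N s && all (fun xy => 2 * xy.2 <= xy.1)%N (zip s (next2 s)).

Definition exc2 (s : seq nat) : nat :=
  (\sum_(xy <- zip s (next2 s)) (xy.1 - 2 * xy.2))%N.

Definition deg2 (s : seq nat) : nat := (\sum_(x <- s) x)%N.

Definition mono2 (A : algType F) (Sq : nat -> A) (s : seq nat) : A :=
  \prod_(x <- s) Sq x.

Definition in_span (T : eqType) (A : lmodType F) (Q : pred T) (f : T -> A)
  (x : A) : Prop :=
  exists (s : seq T) (c : T -> F), all Q s /\ x = \sum_(t <- s) c t *: f t.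

Definition is_basis_fam (T : eqType) (A : lmodType F) (Q : pred T) (f : T -> A)
  : Prop :=
  (forall (s : seq T) (c : T -> F), uniq s -> all Q s ->
      \sum_(t <- s) c t *: f t = 0 -> forall t, t \in s -> c t = 0)
  /\ (forall x, in_span Q f x).

Definition steenrod_odd (A : algType F) (b : A) (P : nat -> A) : Prop :=
  [/\ b * b = 0, P 0%N = 1,
   (forall a c : nat, (a < p * c)%N ->
      P a * P c =
      \sum_(t < (a %/ p).+1)
        ((-1) ^+ (a + t) * ('C((p - 1) * (c - t) - 1, a - p * t))%:R)
          *: (P (a + c - t)%N * P t)),
   (forall a c : nat, (a <= p * c)%N ->
      P a * b * P c =
      \sum_(t < (a %/ p).+1)
        ((-1) ^+ (a + t) * ('C((p - 1) * (c - t), a - p * t))%:R)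
          *: (b * P (a + c - t)%N * P t)
      + \sum_(t < (a %/ p).+1 | (p * t < a)%N)
        ((-1) ^+ (a + t + 1) * ('C((p - 1) * (c - t) - 1, a - p * t - 1))%:R)
          *: (P (a + c - t)%N * b * P t))
   & is_basis_fam adm_odd (mono_odd b P)].

Definition steenrod2 (A : algType F) (Sq : nat -> A) : Prop :=
  [/\ Sq 0%N = 1,
   (forall a c : nat, (a < 2 * c)%N ->
      Sq a * Sq c =
      \sum_(t < a./2.+1)
        ('C(c - t - 1, a - 2 * t))%:R *: (Sq (a + c - t)%N * Sq t))
   & is_basis_fam adm2 (mono2 Sq)].

Definition is_steenrod (A : algType F) (b : A) (P Sq : nat -> A) : Prop :=
  if p == 2%N then steenrod2 Sq else steenrod_odd b P.

(* (F_i A)^k : span of admissible monomials of degree k and excess >= i.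
   For i <= 0 this is the whole degree-k part A^k. *)
Definition Ffilt (A : algType F) (b : A) (P Sq : nat -> A) (i : int) (k : nat)
  : A -> Prop :=
  if p == 2%N then
    in_span (fun s => adm2 s && (deg2 s == k) && (i <= Posz (exc2 s)))
            (mono2 Sq)
  else
    in_span (fun m => adm_odd m && (deg_odd m == k) && (i <= Posz (exc_odd m)))
            (mono_odd b P).

(* The map  V/V' (x) W/W' -> U/U',  [x] (x) [y] |-> [x*y]  (assumed well
   defined) is an isomorphism: equivalently, (U/U', [x],[y] |-> [xy]) has the
   universal property of the tensor product V/V' (x) W/W'.  Linear maps out of
   a quotient S/S' are represented by maps A -> X that are linear on S and
   vanish on S' (only their values on S matter). *)
Definition lin_on (A : lmodType F) (X : lmodType F) (S : A -> Prop) (f : A -> X)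
  : Prop :=
  forall (c : F) u v, S u -> S v -> f (c *: u + v) = c *: f u + f v.

Definition product_induces_iso (A : algType F)
  (V V' W W' U U' : A -> Prop) : Prop :=
  forall (X : lmodType F) (g : A -> A -> X),
    (forall y, W y -> lin_on V (g^~ y)) ->
    (forall x, V x -> lin_on W (g x)) ->
    (forall x y, V' x -> W y -> g x y = 0) ->
    (forall x y, V x -> W' y -> g x y = 0) ->
    exists f : A -> X,
      [/\ lin_on U f, (forall u, U' u -> f u = 0),
          (forall x y, V x -> W y -> g x y = f (x * y)) &
          (forall f' : A -> X, lin_on U f' -> (forall u, U' u -> f' u = 0) ->
             (forall x y, V x -> W y -> g x y = f' (x * y)) ->
             forall u, U u -> f' u = f u)].

End Steenrod.

(* Main.v *)
(* A monomial m = op c * m' is admissible iff exc m' + deg m' is at most the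
   weight w c (2n + e for beta^e P^n, n for Sq^n), and then exc m + deg m' = w c.
   The Adem relations rewrite op x * op c, when x is too small, into products
   op u * op v with w u - deg v > w x - deg c, so by induction on the degree
   op x * A^j lies in F_{w x - j}, and a non-admissible product op x * m lies one
   step further.  For w x = 2i + eps, multiplication by op x therefore matches
   the monomials of degree j and excess at most w x - j with the admissible
   monomials of excess exactly w x - j in degree deg x + j: the latter satisfy
   exc + deg = w x + deg x, which determines their first letter.
   Finally E_{2i+eps} in degree 2i(p-1) + eps is the line spanned by op x. *)
Require Import Defs.
From Stdlib Require Import ClassicalEpsilon.
From HB Require Import structures.
From mathcomp Require Import all_boot all_order all_algebra zify.
Set Implicit Arguments. Unset Strict Implicit. Unset Printing Implicit Defensive.
Import Order.TTheory GRing.Theory Num.Theory.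
Local Open Scope ring_scope.

(** * Closure properties of spans *)

Section Span.
Variables (p : nat) (T : eqType) (A : lmodType 'F_p).
Implicit Types (Q : pred T) (f : T -> A).

(** [in_span] allows repeated generators, whereas freeness in [is_basis_fam] concerns [uniq] lists;
    multiplicities are therefore absorbed into the coefficients. *)
Lemma sum_count (s r : seq T) (G : T -> A) : uniq s -> {subset r <= s} ->
  \sum_(t <- r) G t = \sum_(t <- s) G t *+ count_mem t r.
Proof.
move=> us; elim: r => [|x r IH] sub.
  by rewrite big_nil big1.
rewrite big_cons IH; last by move=> t tr; apply: sub; rewrite inE tr orbT.
under [RHS]eq_bigr do rewrite /= mulrnDr.
rewrite big_split /=; congr (_ + _).
rewrite (bigD1_seq x) //=; last by apply: sub; rewrite mem_head.
rewrite eqxx big1 ?addr0 // => t; rewrite eq_sym => /negbTE -> //.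
Qed.

Lemma in_spanD Q f x y : in_span Q f x -> in_span Q f y -> in_span Q f (x + y).
Proof.
move=> [s1 [c1 [Q1 ->]]] [s2 [c2 [Q2 ->]]].
exists (undup (s1 ++ s2)).
exists (fun t => c1 t *+ count_mem t s1 + c2 t *+ count_mem t s2); split.
  by apply/allP => t; rewrite mem_undup mem_cat => /orP[]; apply/allP.
rewrite (@sum_count (undup (s1 ++ s2)) s1) ?undup_uniq //; last first.
  by move=> t ts; rewrite mem_undup mem_cat ts.
rewrite (@sum_count (undup (s1 ++ s2)) s2) ?undup_uniq //; last first.
  by move=> t ts; rewrite mem_undup mem_cat ts orbT.
by rewrite -big_split /=; apply: eq_bigr => t _; rewrite scalerDl !scalerMnl.
Qed.

Lemma in_span0 Q f : in_span Q f 0.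
Proof. by exists [::], (fun=> 0); rewrite big_nil. Qed.

Lemma in_spanZ Q f (a : 'F_p) x : in_span Q f x -> in_span Q f (a *: x).
Proof.
move=> [s [c [Qs ->]]]; exists s, (fun t => a * c t); split=> //.
by rewrite scaler_sumr; apply: eq_bigr => t _; rewrite scalerA.
Qed.

Lemma in_span_gen Q f t : Q t -> in_span Q f (f t).
Proof.
by move=> Qt; exists [:: t], (fun=> 1); rewrite /= Qt big_seq1 scale1r.
Qed.

Lemma in_span_sum (I : Type) (r : seq I) (R : pred I) Q f (G : I -> A) :
  (forall l, R l -> in_span Q f (G l)) -> in_span Q f (\sum_(l <- r | R l) G l).
Proof.
by move=> QG; elim/big_rec: _ => [|l x /QG]; [apply: in_span0|apply: in_spanD].
Qed.

Lemma in_span_ind Q f (K : A -> Prop) :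
  K 0 -> (forall x y, K x -> K y -> K (x + y)) ->
  (forall (a : 'F_p) x, K x -> K (a *: x)) -> (forall t, Q t -> K (f t)) ->
  forall x, in_span Q f x -> K x.
Proof.
move=> K0 KD KZ Kf x [s [c [/allP Qs ->]]].
rewrite big_seq_cond; elim/big_rec: _ => // t y /andP[ts _] Ky.
by apply: KD => //; apply/KZ/Kf/Qs.
Qed.

Lemma in_spanS Q1 Q2 f x :
  (forall t, Q1 t -> Q2 t) -> in_span Q1 f x -> in_span Q2 f x.
Proof.
move=> sub; apply: in_span_ind; [exact: in_span0|exact: in_spanD|exact: in_spanZ|].
by move=> t /sub; exact: in_span_gen.
Qed.

Lemma in_span_uniq Q f x : in_span Q f x ->
  exists (s : seq T) (c : T -> 'F_p),
    [/\ uniq s, all Q s & x = \sum_(t <- s) c t *: f t].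
Proof.
move=> [s [c [/allP Qs ->]]]; exists (undup s), (fun t => c t *+ count_mem t s).
split; [exact: undup_uniq|by apply/allP => t; rewrite mem_undup; apply: Qs|].
rewrite (@sum_count (undup s)) ?undup_uniq //; last by move=> t; rewrite mem_undup.
by apply: eq_bigr => t _; rewrite scalerMnl.
Qed.

End Span.

(** * Subspaces, partial linear maps and the universal property for a cyclic left factor *)

Definition subspace (p : nat) (A : lmodType 'F_p) (S : A -> Prop) : Prop :=
  S 0 /\ forall c x y, S x -> S y -> S (c *: x + y).

Lemma subspace_span (p : nat) (T : eqType) (A : lmodType 'F_p) (Q : pred T)
  (f : T -> A) : subspace (in_span Q f).
Proof.
split=> [|c x y Qx Qy]; first exact: in_span0.
by apply: in_spanD => //; apply: in_spanZ.
Qed.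

Lemma subspaceB (p : nat) (A : lmodType 'F_p) (S : A -> Prop) x y :
  subspace S -> S x -> S y -> S (x - y).
Proof. by move=> [_ SD] Sx Sy; rewrite addrC -scaleN1r; apply: SD. Qed.

Lemma lin_onD (p : nat) (A X : lmodType 'F_p) (S : A -> Prop) (f : A -> X) x y :
  lin_on S f -> S x -> S y -> f (x + y) = f x + f y.
Proof. by move=> fL Sx Sy; have := fL 1 x y Sx Sy; rewrite !scale1r. Qed.

Lemma lin_on0 (p : nat) (A X : lmodType 'F_p) (S : A -> Prop) (f : A -> X) :
  subspace S -> lin_on S f -> f 0 = 0.
Proof.
move=> [S0 _] fL; apply: (addrI (f 0)).
by rewrite -(lin_onD fL) // !addr0.
Qed.

Lemma lin_onZ (p : nat) (A X : lmodType 'F_p) (S : A -> Prop) (f : A -> X) c x :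
  subspace S -> lin_on S f -> S x -> f (c *: x) = c *: f x.
Proof.
move=> SS fL Sx; have [S0 _] := SS.
by have := fL c x 0 Sx S0; rewrite addr0 (lin_on0 SS fL) addr0.
Qed.

(* The relation [exists y, W y /\ U' (u - v0 * y)] between u and g v0 y is the
   graph of the factorization f; epsilon extracts the function. *)
Lemma cyclic_product_iso (p : nat) (A : algType 'F_p)
    (V V' W W' U U' : A -> Prop) (v0 : A) :
  (forall x, V x <-> exists c : 'F_p, x = c *: v0) ->
  subspace W -> subspace U' ->
  (forall x, U' x -> U x) -> (forall y, W y -> U (v0 * y)) ->
  (forall u, U u -> exists2 y, W y & U' (u - v0 * y)) ->
  (forall y, W y -> U' (v0 * y) -> W' y) ->
  product_induces_iso V V' W W' U U'.
Proof.
move=> VE SW SU' U'U v0W surj inj X g gV gW _ gW'.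
have Vv0 : V v0 by apply/VE; exists 1; rewrite scale1r.
have SV : subspace V.
  split=> [|c x y /VE[d ->] /VE[e ->]]; apply/VE.
    by exists 0; rewrite scale0r.
  by exists (c * d + e); rewrite scalerA scalerDl.
have gv0 := gW _ Vv0.
(* The value [g v0 y] depends only on the class of [v0 * y] modulo [U']: by [inj], two choices of
   [y] differ by an element of [W'], where [g v0] vanishes. *)
have gdet y1 y2 : W y1 -> W y2 -> U' (v0 * y1 - v0 * y2) -> g v0 y1 = g v0 y2.
  move=> W1 W2; have W12 := subspaceB SW W1 W2.
  rewrite -mulrBr => /(inj _ W12) /(gW' _ _ Vv0) g0.
  by rewrite -[y1](subrK y2) (lin_onD gv0) // g0 add0r.
pose R u x := exists y, [/\ W y, U' (u - v0 * y) & x = g v0 y].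
pose f u : X := epsilon (inhabits 0) (R u).
have fP u y : W y -> U' (u - v0 * y) -> f u = g v0 y.
  move=> Wy Uy; have [|z [Wz Uz]] := epsilon_spec (inhabits 0) (R u).
    by exists (g v0 y), y.
  rewrite -/(f u) => ->.
  apply: gdet => //; have := subspaceB SU' Uy Uz.
  by rewrite opprB addrC addrA subrK.
exists f; split.
- move=> c u v /surj[y Wy Uy] /surj[z Wz Uz].
  rewrite (fP _ _ Wy Uy) (fP _ _ Wz Uz) -gv0 //; apply: fP; first exact: SW.2.
  by rewrite mulrDr -scalerAr opprD addrACA -scalerBr; apply: SU'.2.
- move=> u Uu; rewrite (fP u 0) ?mulr0 ?subr0 //; last exact: SW.1.
  exact: lin_on0 gv0.
- move=> x y /VE[c ->] Wy.
  rewrite (lin_onZ c SV (gV _ Wy)) // (fP _ (c *: y)).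
  + by rewrite (lin_onZ c SW gv0).
  + by rewrite -[_ *: _]addr0; apply: SW.2 => //; apply: SW.1.
  + by rewrite -scalerAr -scalerAl subrr; apply: SU'.1.
(* Uniqueness: [u] is the sum of [u - v0 * y], killed by [f'], and [v0 * y], where [g] prescribes
   the value. *)
move=> f' f'lin f'U' gf' u Uu; have [y Wy Uy] := surj u Uu.
rewrite (fP u y) // gf' //; have Uvy := v0W y Wy.
by have := lin_onD f'lin (U'U _ Uy) Uvy; rewrite subrK (f'U' _ Uy) add0r.
Qed.

(** Gluing [c1] on [s1] with [- c2] on [s2] gives a vanishing combination over [s1 ++ s2], to which
    freeness applies. *)
Lemma basis_disjoint (p : nat) (T : eqType) (A : lmodType 'F_p) (Q : pred T)
    (f : T -> A) (s1 s2 : seq T) (c1 c2 : T -> 'F_p) :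
  is_basis_fam Q f -> uniq s1 -> uniq s2 -> all Q s1 -> all Q s2 ->
  (forall t, t \in s1 -> t \notin s2) ->
  \sum_(t <- s1) c1 t *: f t = \sum_(t <- s2) c2 t *: f t ->
  forall t, t \in s1 -> c1 t = 0.
Proof.
move=> [free _] u1 u2 Q1 Q2 dis eqs t ts.
pose c t := if t \in s1 then c1 t else - c2 t.
have := free (s1 ++ s2) c; rewrite cat_uniq u1 u2 andbT all_cat Q1 Q2.
have -> : ~~ has [in s1] s2.
  by apply/hasPn => x; apply: contraL => /dis.
have E1 : \sum_(x <- s1) c x *: f x = \sum_(x <- s1) c1 x *: f x.
  by apply: eq_big_seq => x xs; rewrite /c xs.
have E2 : \sum_(x <- s2) c x *: f x = - \sum_(x <- s2) c2 x *: f x.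
  rewrite -sumrN; apply: eq_big_seq => x xs; rewrite /c ifN ?scaleNr //.
  by apply: contraL xs => /dis.
move=> /(_ isT isT); rewrite big_cat /= E1 E2 eqs subrr => /(_ erefl t).
by rewrite mem_cat ts /c ts; apply.
Qed.

(** * The isomorphism for an abstract excess filtration, from properties shared by all primes *)

Section ExcessFiltration.
Variables (p : nat) (A : algType 'F_p) (T I : eqType).
Variables (adm : pred T) (deg exc : T -> nat) (f : T -> A).
Variables (op : I -> A) (w D : I -> nat).
Variables (push : I -> T -> T) (hd : T -> I) (tl : T -> T) (one : T).

Definition exc_filt (i : int) (k : nat) : A -> Prop :=
  in_span (fun t => adm t && (deg t == k) && (i <= Posz (exc t))) f.

Hypothesis basis : is_basis_fam adm f.
Hypothesis oneP : [/\ adm one, deg one = 0%N, exc one = 0%N & f one = 1].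
Hypothesis deg_eq0 : forall m, adm m -> deg m = 0%N -> m = one.
Hypothesis pushP : forall x m, adm m -> (exc m + deg m <= w x)%N ->
  [/\ adm (push x m), f (push x m) = op x * f m,
      deg (push x m) = (D x + deg m)%N, (exc (push x m) + deg m = w x)%N
    & tl (push x m) = m].
Hypothesis unpushP : forall m, adm m ->
  [/\ adm (tl m), (exc (tl m) + deg (tl m) <= w (hd m))%N
    & push (hd m) (tl m) = m].
Hypothesis adem : forall x c, (w x < w c + D c)%N ->
  in_span (fun uv : I * I => [&& D uv.2 < D c, D uv.1 + D uv.2 == D x + D c
                               & w x + D uv.2 < w uv.1 + D c]%N)
          (fun uv => op uv.1 * op uv.2) (op x * op c).
(** As [exc m + deg m = w (hd m) + D (hd m)], excess and degree determine the first letter; this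
    yields surjectivity. *)
Hypothesis sum_inj : forall x y, (w x + D x = w y + D y)%N -> x = y.
(** With [d] the degree of the tail, this forces a monomial of degree [D y] and excess at least
    [w y] to be the single letter [y]. *)
Hypothesis top_inj :
  forall x y d, (w y + d <= w x)%N -> (D x + d = D y)%N -> x = y.

Lemma exc_filt_gen i k m :
  adm m -> deg m = k -> i <= Posz (exc m) -> exc_filt i k (f m).
Proof. by move=> am <- im; apply: in_span_gen; rewrite am eqxx im. Qed.

Lemma exc_filtS i i' k x : i' <= i -> exc_filt i k x -> exc_filt i' k x.
Proof.
move=> ii'; apply: in_spanS => t /andP[/andP[-> ->]] /=; exact: le_trans.
Qed.

Lemma exc_filt0 i k x : exc_filt i k x -> exc_filt 0 k x.
Proof. by apply: in_spanS => t /andP[-> _]. Qed.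

Lemma exc_filt_shift i k i' k' z :
  (forall m, adm m -> deg m = k -> i <= Posz (exc m) -> exc_filt i' k' (z * f m)) ->
  forall x, exc_filt i k x -> exc_filt i' k' (z * x).
Proof.
have [S0 SD] := subspace_span (fun t => adm t && (deg t == k') && (i' <= Posz (exc t))) f.
move=> h; apply: in_span_ind.
- by rewrite mulr0.
- by move=> x y hx hy; rewrite mulrDr -[_ * x]scale1r; apply: SD.
- by move=> c x hx; rewrite -scalerAr -[_ *: _]addr0; apply: SD.
- by move=> m /andP[/andP[am /eqP dm]]; apply: h.
Qed.

Lemma monomial_split m : adm m ->
  [/\ deg m = (D (hd m) + deg (tl m))%N, (exc m + deg (tl m) = w (hd m))%N
    & f m = op (hd m) * f (tl m)].
Proof.
by move=> /unpushP[at_ le_ eq_]; have [_] := pushP at_ le_; rewrite eq_.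
Qed.

(** Both claims go through one strong induction: the first at [d] uses the second in smaller
    degrees, and the second at [d] sorts monomials into admissible products and those covered by the
    first. *)
Lemma op_exc_filt d :
  (forall x m, adm m -> deg m = d -> (w x < exc m + deg m)%N ->
     exc_filt (Posz (w x) - Posz d + 1) (D x + d) (op x * f m)) /\
  (forall x y, exc_filt 0 d y ->
     exc_filt (Posz (w x) - Posz d) (D x + d) (op x * y)).
Proof.
elim/ltn_ind: d => d IH.
have strict x m : adm m -> deg m = d -> (w x < exc m + deg m)%N ->
  exc_filt (Posz (w x) - Posz d + 1) (D x + d) (op x * f m).
  move=> am dm lt; have [at_ _ _] := unpushP am.
  have [dE eE ->] := monomial_split am.
  (* The right-hand side equals [exc m + deg m]. *)
  have /adem : (w x < w (hd m) + D (hd m))%N by lia.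
  rewrite mulrA; move: (op x * op _).
  have [S0 SD] := subspace_span (fun t => adm t && (deg t == (D x + d)%N)
    && (Posz (w x) - Posz d + 1 <= Posz (exc t))) f.
  apply: in_span_ind.
  - by rewrite mul0r.
  - by move=> y z hy hz; rewrite mulrDl -[y * _]scale1r; apply: SD.
  - by move=> c y hy; rewrite -scalerAl -[_ *: _]addr0; apply: SD.
  move=> [u v] /= /and3P[lt1 /eqP eq2 lt3]; rewrite -mulrA.
  (* [D v < D (hd m)] makes [D (hd m)] positive. The induction hypothesis is then used twice: for
     [op v] on the tail, keeping only the degree, and for [op u] on the result, where [lt3] supplies
     the extra filtration step. *)
  have lt_tl : (deg (tl m) < d)%N by lia.
  have vt : exc_filt 0 (D v + deg (tl m)) (op v * f (tl m)).
    by apply: exc_filt0 ((IH _ lt_tl).2 v _ _); apply: exc_filt_gen.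
  have lt4 : (D v + deg (tl m) < d)%N by lia.
  have := (IH _ lt4).2 u _ vt; rewrite addnA eq2.
  have -> : (D x + D (hd m) + deg (tl m) = D x + d)%N by lia.
  by apply: exc_filtS; lia.
split=> // x; apply: exc_filt_shift => m am dm _.
have [le|lt] := leqP (exc m + deg m) (w x); last first.
  by apply: exc_filtS (strict _ _ am dm lt); lia.
have [ap <- dp ep _] := pushP am le.
by apply: exc_filt_gen => //; lia.
Qed.

Lemma exc_filt_product_iso x0 j :
  product_induces_iso
    (exc_filt (Posz (w x0)) (D x0))
    (exc_filt (Posz (w x0) + 1) (D x0))
    (exc_filt 0 j)
    (exc_filt (Posz (w x0) - Posz j + 1) j)
    (exc_filt (Posz (w x0) - Posz j) (D x0 + j))
    (exc_filt (Posz (w x0) - Posz j + 1) (D x0 + j)).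
Proof.
have [a1 d1 e1 f1] := oneP.
have le1 x : (exc one + deg one <= w x)%N by rewrite d1 e1.
apply: (@cyclic_product_iso _ _ _ _ _ _ _ _ (op x0)).
- have [ap fp dp ep _] := pushP a1 (le1 x0).
  have fp0 : f (push x0 one) = op x0 by rewrite fp f1 mulr1.
  move=> x; split=> [|[c ->]].
    move: x; apply: in_span_ind.
    + by exists 0; rewrite scale0r.
    + by move=> _ _ [c ->] [d ->]; exists (c + d); rewrite scalerDl.
    + by move=> c _ [d ->]; exists (c * d); rewrite scalerA.
    move=> m /andP[/andP[am /eqP dm] em]; exists 1; rewrite scale1r -fp0.
    have [at_ _ eq_] := unpushP am; have [dE eE _] := monomial_split am.
    have hE : hd m = x0 by apply: (top_inj (d := deg (tl m))); lia.
    by rewrite -eq_ hE (deg_eq0 at_) //; move: dE; rewrite hE; lia.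
  rewrite -fp0; apply: in_spanZ; apply: exc_filt_gen => //; lia.
- exact: subspace_span.
- exact: subspace_span.
- by move=> x; apply: exc_filtS; lia.
- by move=> y; apply: (op_exc_filt j).2.
- apply: in_span_ind.
  + by exists 0; [apply: in_span0|rewrite mulr0 subrr; apply: in_span0].
  + move=> u v [y Wy Uy] [z Wz Uz]; exists (y + z); first exact: in_spanD.
    by rewrite mulrDr opprD addrACA; apply: in_spanD.
  + move=> c u [y Wy Uy]; exists (c *: y); first exact: in_spanZ.
    by rewrite -scalerAr -scalerBr; apply: in_spanZ.
  move=> m /andP[/andP[am /eqP dm]].
  (* A monomial above the bound vanishes in the quotient and has preimage 0; one exactly on it is
     [op x0] times its tail. *)
  rewrite le_eqVlt => /orP[/eqP em|em]; last first.
    exists 0; first exact: in_span0.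
    by rewrite mulr0 subr0; apply: exc_filt_gen => //; lia.
  have [at_ _ eq_] := unpushP am; have [dE eE fE] := monomial_split am.
  have hE : hd m = x0 by apply: sum_inj; lia.
  exists (f (tl m)); last by rewrite fE hE subrr; apply: in_span0.
  by apply: exc_filt_gen => //; move: dE; rewrite hE; lia.
move=> y /in_span_uniq[s [c [us /allP Qs ->]]] Uy.
(* The low monomials are those that [op x0] can be pushed onto; the others already lie in the
   filtration step to be reached, so the low coefficients must be shown to vanish. *)
pose low m := (exc m + deg m <= w x0)%N.
have highP m : m \in s -> ~~ low m ->
    [/\ adm m, deg m = j & Posz (w x0) - Posz j + 1 <= Posz (exc m)].
  by move=> /Qs /andP[/andP[am /eqP dm] _]; rewrite /low => h; split=> //; lia.
have lowP m : m \in filter low s -> [/\ adm m, deg m = j & low m].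
  by rewrite mem_filter => /andP[lm] /Qs /andP[/andP[am /eqP dm] _].
rewrite (bigID low) /=; apply: in_spanD; last first.
  rewrite big_seq_cond; apply: in_span_sum => m /andP[/highP h /h[am dm em]].
  by apply: in_spanZ; apply: exc_filt_gen.
suff c0 m : m \in filter low s -> c m = 0.
  rewrite -big_filter big_seq big1; first exact: in_span0.
  by move=> m /c0 ->; rewrite scale0r.
(* The low part of the product is the whole product minus its high part, and the latter is in the
   deeper step by the strict half of [op_exc_filt]. The coefficient [c (tl t)] is [c m], as [tl]
   undoes the push. *)
have Us2 : exc_filt (Posz (w x0) - Posz j + 1) (D x0 + j)
    (\sum_(t <- [seq push x0 m | m <- filter low s]) c (tl t) *: f t).
  have -> : \sum_(t <- [seq push x0 m | m <- filter low s]) c (tl t) *: f t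
    = op x0 * (\sum_(m <- s) c m *: f m)
      - op x0 * (\sum_(m <- s | ~~ low m) c m *: f m).
    rewrite -mulrBr [X in X - _](bigID low) /= addrK mulr_sumr big_map.
    rewrite -[in RHS]big_filter big_seq [RHS]big_seq; apply: eq_bigr => n /lowP[am dm lm].
    by have [_ -> _ _ ->] := pushP am lm; rewrite scalerAr.
  apply: subspaceB => //; first exact: subspace_span.
  rewrite mulr_sumr big_seq_cond; apply: in_span_sum => n /andP[ns lm].
  rewrite -scalerAr; apply: in_spanZ; have [am dm _] := highP _ ns lm.
  by apply: (op_exc_filt j).1 => //; rewrite ltnNge.
have [s2 [c2 [us2 /allP Qs2 eqs]]] := in_span_uniq Us2.
move=> ms; have [am dm lm] := lowP m ms; have [_ _ _ _ tE] := pushP am lm.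
(* Pushed low monomials have excess exactly [w x0 - j], those of [s2] strictly more, so the two
   lists are disjoint. *)
rewrite -tE; apply: (basis_disjoint basis _ us2 _ _ _ eqs).
- rewrite map_inj_in_uniq ?filter_uniq // => m1 m2 /lowP[a1' _ l1] /lowP[a2 _ l2] eq12.
  have [_ _ _ _ <-] := pushP a1' l1; have [_ _ _ _ <-] := pushP a2 l2.
  by rewrite eq12.
- by apply/allP => _ /mapP[m1 /lowP[am1 _ l1] ->]; have [] := pushP am1 l1.
- by apply/allP => t /Qs2 /andP[/andP[]].
- move=> _ /mapP[m1 /lowP[am1 dm1 l1] ->]; have [_ _ _ e_ _] := pushP am1 l1.
  by apply/negP => /Qs2 /andP[_]; lia.
exact: map_f.
Qed.
End ExcessFiltration.

(** * The prime 2: Steenrod squares *)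

Section EvenPrime.
Variables (A : algType 'F_2) (b : A) (P Sq : nat -> A).
Hypothesis HA : steenrod2 Sq.

(* Admissible monomials have positive exponents, so Sq^0 = 1 has to be dropped;
   push2 0 s is only meaningful for s = [::]. *)
Definition push2 (n : nat) (s : seq nat) : seq nat :=
  if n == 0%N then [::] else n :: s.

Lemma zip_next2 n s :
  zip (n :: s) (next2 (n :: s)) = (n, head 0%N s) :: zip s (next2 s).
Proof. by case: s. Qed.

Lemma adm2_cons n s :
  adm2 (n :: s) = [&& 0 < n, 2 * head 0 s <= n & adm2 s]%N.
Proof.
rewrite /adm2 zip_next2 /=.
by case: (0 < n)%N => //=; rewrite andbCA.
Qed.

(** Adding the degree makes the excess telescope; the condition [exc2 s + deg2 s <= n] thus becomes
    admissibility of [n :: s]. *)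
Lemma exc2_deg2 s : adm2 s -> (exc2 s + deg2 s = 2 * head 0 s)%N.
Proof.
elim: s => [|n s IH]; first by rewrite /exc2 /deg2 !big_nil.
rewrite adm2_cons => /and3P[n0 le /IH].
by rewrite /exc2 /deg2 zip_next2 !big_cons /=; lia.
Qed.

Lemma adm2_head0 s : adm2 s -> head 0%N s = 0%N -> s = [::].
Proof. by case: s => // n s; rewrite adm2_cons => /andP[] /=; lia. Qed.

Lemma push2P n s : adm2 s -> (exc2 s + deg2 s <= n)%N ->
  [/\ adm2 (push2 n s), mono2 Sq (push2 n s) = Sq n * mono2 Sq s,
      deg2 (push2 n s) = (n + deg2 s)%N, (exc2 (push2 n s) + deg2 s = n)%N
    & behead (push2 n s) = s].
Proof.
move=> as_ le; have [Sq0 _ _] := HA; have E := exc2_deg2 as_.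
rewrite /push2; case: eqVneq => [n0|n0].
  have -> : s = [::] by apply: adm2_head0 => //; lia.
  by rewrite n0 Sq0 mul1r /exc2 /deg2 /= !big_nil.
rewrite adm2_cons as_; split=> //; [lia|by rewrite /mono2 big_cons|by rewrite /deg2 big_cons|].
by rewrite /exc2 zip_next2 big_cons -/(exc2 s) /=; lia.
Qed.

Lemma push2_behead s : adm2 s ->
  [/\ adm2 (behead s), (exc2 (behead s) + deg2 (behead s) <= head 0 s)%N
    & push2 (head 0%N s) (behead s) = s].
Proof.
case: s => [|n s] /=; first by rewrite /exc2 /deg2 !big_nil.
rewrite adm2_cons => /and3P[n0 le as_]; rewrite exc2_deg2 //; split=> //.
by rewrite /push2; case: eqP n0 => // ->.
Qed.

Lemma adem2_span x c : (x < c + c)%N ->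
  in_span (fun uv : nat * nat => [&& uv.2 < c, uv.1 + uv.2 == x + c
                                   & x + uv.2 < uv.1 + c]%N)
          (fun uv => Sq uv.1 * Sq uv.2) (Sq x * Sq c).
Proof.
move=> lt; have [_ adem _] := HA; rewrite adem; last by lia.
apply: in_span_sum => t _; apply: in_spanZ.
have := @in_span_gen _ _ A _ (fun uv => Sq uv.1 * Sq uv.2)
  ((x + c - t)%N, nat_of_ord t).
(* Since [t] is at most half of [x] and [x < 2 * c], one has [t < c], which gives both strict
   inequalities. *)
by apply=> /=; have := ltn_ord t; lia.
Qed.

Lemma deg2_eq0 s : adm2 s -> deg2 s = 0%N -> s = [::].
Proof.
case: s => // n s; rewrite adm2_cons /deg2 big_cons => /andP[n0 _]; lia.
Qed.

Lemma steenrod2_product_iso n j :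
  product_induces_iso
    (Ffilt b P Sq (Posz n) n)
    (Ffilt b P Sq (Posz n + 1) n)
    (Ffilt b P Sq 0 j)
    (Ffilt b P Sq (Posz n - Posz j + 1) j)
    (Ffilt b P Sq (Posz n - Posz j) (n + j))
    (Ffilt b P Sq (Posz n - Posz j + 1) (n + j)).
Proof.
have [Sq0 _ basis] := HA.
(* Weight and degree of [Sq n] are both [n]. *)
apply: (@exc_filt_product_iso 2 A _ _ adm2 deg2 exc2 (mono2 Sq) Sq id id push2
  (head 0%N) behead [::]) => //.
- by rewrite /mono2 /deg2 /exc2 !big_nil.
- exact: deg2_eq0.
- exact: push2P.
- exact: push2_behead.
- exact: adem2_span.
- by move=> x y; lia.
- by move=> x y d; lia.
Qed.

End EvenPrime.

(** * Odd primes: Bocksteins and reduced powers *)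

Section OddPrime.
Variables (p : nat) (A : algType 'F_p) (b : A) (P Sq : nat -> A).
Hypotheses (p_prime : prime p) (p_neq2 : p != 2%N) (HA : steenrod_odd b P).

Definition wt_odd (x : bool * nat) : nat := (2 * x.2 + x.1)%N.
Definition opdeg_odd (x : bool * nat) : nat := (2 * x.2 * (p - 1) + x.1)%N.
Definition op_odd (x : bool * nat) : A := b ^+ x.1 * P x.2.
(* As for push2, P^0 = 1 is dropped, so that beta^e alone is pushed by (e, 0). *)
Definition push_odd (x : bool * nat) (m : odd_mono) : odd_mono :=
  (x.1, if x.2 == 0%N then [::] else (x.2, m.1) :: m.2).
Definition pow_odd (m : odd_mono) : nat := head 0%N (map fst m.2).
Definition tail_odd (m : odd_mono) : odd_mono :=
  if m.2 is x :: s then (x.2, s) else (false, [::]).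

Lemma zip_next_pows x s :
  zip (x :: s) (next_pows (x :: s)) =
    (x, head 0%N (map fst s)) :: zip s (next_pows s).
Proof. by case: s. Qed.

Lemma adm_odd_cons e x s :
  adm_odd p (e, x :: s) =
    [&& 0 < x.1, p * pow_odd (x.2, s) + x.2 <= x.1 & adm_odd p (x.2, s)]%N.
Proof.
rewrite /adm_odd zip_next_pows /=.
by case: (0 < x.1)%N => //=; rewrite andbCA.
Qed.

Lemma deg_odd_cons e x s :
  deg_odd p (e, x :: s) = (opdeg_odd (e, x.1) + deg_odd p (x.2, s))%N.
Proof. by rewrite /deg_odd /opdeg_odd big_cons /=; lia. Qed.

Lemma exc_odd_cons e x s :
  exc_odd p (e, x :: s) =
    (e + exc_odd p (x.2, s) + 2 * (x.1 - p * pow_odd (x.2, s) - x.2))%N.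
Proof. by rewrite /exc_odd zip_next_pows !big_cons /pow_odd /=; lia. Qed.

(** Telescoping again: the power $i_s$ contributes $2i_s+2i_s(p-1)=2pi_s$, which the preceding
    letter subtracts unless $s=1$; every Bockstein after the leading one cancels. *)
Lemma exc_deg_odd m : adm_odd p m ->
  (exc_odd p m + deg_odd p m = 2 * (p * pow_odd m + m.1))%N.
Proof.
have p1 := prime_gt1 p_prime.
case: m => e s; elim: s e => [|x s IH] e.
  by rewrite /exc_odd /deg_odd !big_nil /pow_odd /=; lia.
rewrite adm_odd_cons => /and3P[n0 le /IH] /=.
rewrite exc_odd_cons deg_odd_cons /opdeg_odd /=.
rewrite {3}/pow_odd /=; move: le; move: (p * pow_odd _)%N => h le E.
have -> : (p * x.1 = x.1 * (p - 1) + x.1)%N by nia.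
by rewrite -[(2 * _ * _)%N]mulnA; move: (x.1 * (p - 1))%N => z; lia.
Qed.

Lemma adm_odd_pow0 m :
  adm_odd p m -> (pow_odd m + m.1 = 0)%N -> m = (false, [::]).
Proof.
case: m => e [|x s]; first by case: e.
by rewrite adm_odd_cons /pow_odd => /andP[] /=; lia.
Qed.

Lemma push_oddP x m :
  adm_odd p m -> (exc_odd p m + deg_odd p m <= wt_odd x)%N ->
  [/\ adm_odd p (push_odd x m),
      mono_odd b P (push_odd x m) = op_odd x * mono_odd b P m,
      deg_odd p (push_odd x m) = (opdeg_odd x + deg_odd p m)%N,
      (exc_odd p (push_odd x m) + deg_odd p m = wt_odd x)%N
    & tail_odd (push_odd x m) = m].
Proof.
move=> am; have [_ P0 _ _ _] := HA; have E := exc_deg_odd am.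
case: x => e n; rewrite E /push_odd /wt_odd /op_odd /= => le.
have le' : (p * pow_odd m + m.1 <= n)%N by move: le; case: e => /=; lia.
case: eqVneq => [n0|n0].
  have p1 := prime_gt1 p_prime.
  have -> : m = (false, [::]) by apply: adm_odd_pow0 => //; nia.
  rewrite n0 P0 /mono_odd /exc_odd /deg_odd /opdeg_odd /= !big_nil !mulr1.
  by split=> //; lia.
case: m am E le le' => e1 s am E le le'.
rewrite adm_odd_cons deg_odd_cons exc_odd_cons /= am le' lt0n n0; split=> //.
  by rewrite /mono_odd big_cons /= !mulrA.
by move: E le'; rewrite /=; move: (p * _)%N => h; lia.
Qed.

Lemma push_tail_odd m : adm_odd p m ->
  [/\ adm_odd p (tail_odd m),
      (exc_odd p (tail_odd m) + deg_odd p (tail_odd m) <= wt_odd (m.1, pow_odd m))%N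
    & push_odd (m.1, pow_odd m) (tail_odd m) = m].
Proof.
case: m => e [|[n e1] s].
  by rewrite /exc_odd /deg_odd /= !big_nil.
rewrite adm_odd_cons /= => /and3P[n0 le am].
rewrite exc_deg_odd // /wt_odd /push_odd /pow_odd /=; split=> //.
  by move: le; rewrite /pow_odd /=; lia.
by case: eqP n0 => // ->.
Qed.

Lemma adem_odd_span x c : (wt_odd x < wt_odd c + opdeg_odd c)%N ->
  in_span (fun uv : (bool * nat) * (bool * nat) =>
             [&& opdeg_odd uv.2 < opdeg_odd c,
                 opdeg_odd uv.1 + opdeg_odd uv.2 == opdeg_odd x + opdeg_odd c
               & wt_odd x + opdeg_odd uv.2 < wt_odd uv.1 + opdeg_odd c]%N)
          (fun uv => op_odd uv.1 * op_odd uv.2) (op_odd x * op_odd c).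
Proof.
have [bb _ PP PbP _] := HA; have p1 := prime_gt1 p_prime.
case: x c => e n [e0 c]; rewrite /wt_odd /opdeg_odd /= => lt.
(* Weight plus degree of [(e0, c)] is [2 * (p * c + e0)], so the bound gives the range of the Adem
   relation: the plain one for [e0 = false], the one with an inner Bockstein otherwise. *)
have {}lt : (n < p * c + e0)%N.
  suff : (2 * n < 2 * (p * c + e0))%N by lia.
  have -> : (p * c = c * (p - 1) + c)%N by nia.
  by move: lt; rewrite -[(2 * c * _)%N]mulnA; move: (c * (p - 1))%N => z; lia.
have tle (t : 'I_(n %/ p).+1) : (p * t <= n)%N.
  by apply: leq_trans (leq_trunc_div n p); rewrite mulnC leq_mul2r -ltnS ltn_ord orbT.
case: e0 lt => lt; last first.
  have lt' : (n < p * c)%N by lia.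
  have -> : op_odd (e, n) * op_odd (false, c) = b ^+ e * (P n * P c).
    by rewrite /op_odd /= expr0 mul1r mulrA.
  rewrite PP // mulr_sumr.
  apply: in_span_sum => t _; rewrite -scalerAr; apply: in_spanZ.
  have := tle t; move: (nat_of_ord t) => {}t tn.
  have tc : (t < c)%N by nia.
  have := @in_span_gen _ _ A _ (fun uv => op_odd uv.1 * op_odd uv.2)
     ((e, (n + c - t)%N), (false, t)).
  rewrite /op_odd /= expr0 mul1r -mulrA; apply.
  (* This form of [c] removes truncated subtraction before [nia]. *)
  have [r rE] : exists r, c = (t + r.+1)%N by exists (c - t).-1; lia.
  rewrite /= rE (_ : n + (t + r.+1) - t = n + r.+1)%N; last by lia.
  by apply/and3P; split; nia.
have le : (n <= p * c)%N by lia.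
have -> : op_odd (e, n) * op_odd (true, c) = b ^+ e * (P n * b * P c).
  by rewrite /op_odd /= expr1 !mulrA.
rewrite PbP // mulrDr !mulr_sumr; apply: in_spanD; apply: in_span_sum => t.
  move=> _; rewrite -scalerAr; apply: in_spanZ.
  have := tle t; move: (nat_of_ord t) => {}t tn.
  (* Here [t = c] can occur; the Bockstein in [(true, c)] still makes the degree drop strict. *)
  have tc : (t <= c)%N by nia.
  case: e; first by rewrite expr1 !mulrA bb !mul0r; apply: in_span0.
  have := @in_span_gen _ _ A _ (fun uv => op_odd uv.1 * op_odd uv.2)
     ((true, (n + c - t)%N), (false, t)).
  rewrite /op_odd /= !expr0 expr1 !mul1r; apply.
  have [r rE] : exists r, c = (t + r)%N by exists (c - t)%N; lia.
  rewrite /= rE (_ : n + (t + r) - t = n + r)%N; last by lia.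
  by apply/and3P; split; nia.
move=> lt_t; rewrite -scalerAr; apply: in_spanZ.
move: lt_t; move: (nat_of_ord t) => {}t tn.
(* Now both right factors carry a Bockstein, so strictness must come from the summation condition
   [p * t < n]. *)
have tc : (t < c)%N by nia.
have := @in_span_gen _ _ A _ (fun uv => op_odd uv.1 * op_odd uv.2)
   ((e, (n + c - t)%N), (true, t)).
rewrite /op_odd /= expr1 !mulrA; apply.
have [r rE] : exists r, c = (t + r.+1)%N by exists (c - t).-1; lia.
rewrite /= rE (_ : n + (t + r.+1) - t = n + r.+1)%N; last by lia.
  by apply/and3P; split; nia.
Qed.

Lemma deg_odd_eq0 m : adm_odd p m -> deg_odd p m = 0%N -> m = (false, [::]).
Proof.
have p1 := prime_gt1 p_prime.
case: m => e [|x s]; first by case: e => //; rewrite /deg_odd big_nil.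
rewrite adm_odd_cons deg_odd_cons /opdeg_odd /= => /andP[n0 _] h; nia.
Qed.

Lemma steenrod_odd_product_iso i (eps : bool) j :
  let a := Posz (2 * i + eps)%N in
  let k := (2 * i * (p - 1) + eps)%N in
  product_induces_iso
    (Ffilt b P Sq a k)
    (Ffilt b P Sq (a + 1) k)
    (Ffilt b P Sq 0 j)
    (Ffilt b P Sq (a - Posz j + 1) j)
    (Ffilt b P Sq (a - Posz j) (k + j))
    (Ffilt b P Sq (a - Posz j + 1) (k + j)).
Proof.
have [_ P0 _ _ basis] := HA; have p1 := prime_gt1 p_prime.
rewrite /= /Ffilt (negbTE p_neq2).
apply: (@exc_filt_product_iso p A _ _ (adm_odd p) (deg_odd p) (exc_odd p)
  (mono_odd b P) op_odd wt_odd opdeg_odd push_odd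
  (fun m => (m.1, pow_odd m)) tail_odd (false, [::]) _ _ _ _ _ _ _ _ (eps, i)).
- exact: basis.
- by rewrite /mono_odd /deg_odd /exc_odd /= !big_nil mulr1.
- exact: deg_odd_eq0.
- exact: push_oddP.
- exact: push_tail_odd.
- exact: adem_odd_span.
- move=> [e n] [e' n']; rewrite /wt_odd /opdeg_odd /= => E.
  (* Half of weight plus degree; as [e <= 1 < p], it determines [n] and [e]. *)
  have {}E : (n * p + e = n' * p + e')%N.
    have pE : p = (p - 1).+1 by lia.
    by rewrite pE !mulnS; lia.
  have nn' : n = n' by case: e e' E => [] [] /=; nia.
  by move: E; rewrite nn' => /addnI; case: e; case: e'.
- move=> [e n] [e' n'] d; rewrite /wt_odd /opdeg_odd /= => le E.
  (* Changing [n] moves weight and degree by at least 2, the Bockstein exponents by at most 1: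
     [n' < n] contradicts [E], and [n < n'] contradicts [le]. *)
  have nn' : n = n' by case: e e' le E => [] [] /=; nia.
  by move: le E; rewrite nn'; case: e; case: e' => //=; lia.
Qed.

End OddPrime.

Theorem theorem2p2 (p : nat) (p_prime : prime p) (A : algType 'F_p)
  (b : A) (P Sq : nat -> A) (HA : is_steenrod b P Sq)
  (i j : nat) (eps : bool) :
  let a : int := Posz (2 * i + eps)%N in
  let k : nat := (2 * i * (p - 1) + eps)%N in
  product_induces_iso
    (Ffilt b P Sq a k)                   (* F_a^k          *)
    (Ffilt b P Sq (a + 1) k)             (* F_{a+1}^k      *)
    (Ffilt b P Sq 0 j)                   (* A^j            *)
    (Ffilt b P Sq (a - Posz j + 1) j)    (* F_{a-j+1}^j    *)
    (Ffilt b P Sq (a - Posz j) (k + j))  (* F_{a-j}^{k+j}  *)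
    (Ffilt b P Sq (a - Posz j + 1) (k + j)). (* F_{a-j+1}^{k+j} *)
Proof.
move: HA; rewrite /is_steenrod; case: (eqVneq p 2%N) => [p2|p_neq2 HA].
  (* At [p = 2] the factor [p - 1] is 1, so excess and degree are both [2 * i + eps]. *)
  subst p => HA; rewrite /= muln1; exact: steenrod2_product_iso.
exact: steenrod_odd_product_iso.
Qed.
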